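(* Let $d\ge2$, let $T\in\mathbb{R}^{n_1\times\cdots\times n_d}$ be given by a TT-representation with cores $G_1,\ldots,G_d$ and ranks $(1,r_1,\ldots,r_{d-1},1)$, and let $\widetilde r_0$ be a divisor of $r_1$. If $\widetilde T(i_1,\ldots,i_d)=\operatorname{Trace}(\widetilde G_1(i_1)\cdots\widetilde G_d(i_d))$ denotes the output of the edge insertion algorithm called with input $T$ and $\widetilde r_0$, then $\widetilde T(i_1,\ldots,i_d)=T(i_1,\ldots,i_d)$ for all $i_1,\ldots,i_d$.
   Context: TR-format: cores $G_k\in\mathbb{R}^{r_{k-1}\times n_k\times r_k}$ ($k=1,\ldots,d$, $r_d=r_0$), with matrix slices $G_k(i_k)\in\mathbb{R}^{r_{k-1}\times r_k}$, represent $T(i_1,\ldots,i_d)=\operatorname{Trace}(G_1(i_1)\cdots G_d(i_d))$. A TT-representation is a TR-representation with $r_0=r_d=1$. Edge insertion algorithm (input: TT-cores $G_1,\ldots,G_d$, divisor $\widetilde r_0$ of $r_1$). Partition $$G_1(i_1)=\begin{bmatrix}G_1^{(1)}(i_1)&\cdots&G_1^{(\widetilde r_0)}(i_1)\end{bmatrix},\qquad G_2(i_2)=\begin{bmatrix}G_2^{(1)}(i_2)\\ \vdots\\ G_2^{(\widetilde r_0)}(i_2)\end{bmatrix},$$ where $G_1^{(j)}(i_1)\in\mathbb{R}^{1\times (r_1/\widetilde r_0)}$ and $G_2^{(j)}(i_2)\in\mathbb{R}^{(r_1/\widetilde r_0)\times r_2}$. The output cores are $$\widetilde G_1(i_1)=\begin{bmatrix}G_1^{(1)}(i_1)\\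 \vdots\\ G_1^{(\widetilde r_0)}(i_1)\end{bmatrix},\qquad \widetilde G_2(i_2)=\begin{bmatrix}G_2^{(1)}(i_2)&\cdots&G_2^{(\widetilde r_0)}(i_2)\end{bmatrix},$$ and, for $k=3,\ldots,d$, $\widetilde G_k(i_k)=\operatorname{blockdiag}(G_k(i_k))$, the block diagonal matrix with $\widetilde r_0$ diagonal blocks all equal to $G_k(i_k)$. *)

(* Defs.v *)
From HB Require Import structures.
From mathcomp Require Import all_boot all_order all_algebra.
From mathcomp Require Import reals.

Set Implicit Arguments.
Unset Strict Implicit.
Unset Printing Implicit Defensive.

Import GRing.Theory.
Local Open Scope ring_scope.

(* Modes and cores are numbered from 0: the core G_k of the usual notation is
   [tr_core (k - 1)], while the rank r_k is [tr_rank k]. Only the values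
   [tr_rank k] with k <= d are ever used. *)
Record tr_rep (R : realType) (d : nat) (n : 'I_d -> nat) := TRRep {
  tr_rank : nat -> nat;
  tr_core : forall k : 'I_d, 'I_(n k) -> 'M[R]_(tr_rank k, tr_rank k.+1);
  tr_rank_cyclic : tr_rank d = tr_rank 0
}.

Section TRFormat.
Variables (R : realType) (d : nat) (n : 'I_d -> nat).

Definition multi_index := forall k : 'I_d, 'I_(n k).
Definition tensor := multi_index -> R.

Fixpoint tr_prod (G : tr_rep R n) (i : multi_index) (k : nat) :
    (k <= d)%N -> 'M[R]_(tr_rank G 0, tr_rank G k) :=
  match k with
  | 0 => fun _ => 1%:M
  | k'.+1 => fun lt_k'd =>
      tr_prod G i (ltnW lt_k'd)
        *m tr_core G (i (Ordinal lt_k'd))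
  end.

Definition tr_tensor (G : tr_rep R n) : tensor := fun i =>
  \tr (castmx (erefl, tr_rank_cyclic G) (tr_prod G i (leqnn d))).

Definition represents (G : tr_rep R n) (T : tensor) : Prop :=
  forall i, T i = tr_tensor G i.

Record tt_rep := TTRep {
  tt_tr :> tr_rep R n;
  tt_rank_first : tr_rank tt_tr 0 = 1%N;
  tt_rank_last : tr_rank tt_tr d = 1%N
}.

End TRFormat.

Section EdgeInsertion.
Variables (R : realType) (d : nat) (n : 'I_d -> nat).
Variables (G : tt_rep R n) (q : nat).
Hypotheses (d_ge2 : (2 <= d)%N) (q_dvd : (q %| tr_rank G 1)%N).

(* The sums are the block sizes produced by \mxcol, \mxrow and \mxblock; they
   equal q for k = 0 and q * r_k for k >= 2, see [ei_rankE]. *)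
Definition ei_rank (k : nat) : nat :=
  match k with
  | 0 => (\sum_(j < q) tr_rank G 0)%N
  | 1 => (tr_rank G 1 %/ q)%N
  | _ => (\sum_(j < q) tr_rank G k)%N
  end.

Lemma ei_rankE (k : nat) :
  ei_rank k = if k == 0%N then q
              else if k == 1%N then (tr_rank G 1 %/ q)%N
              else (q * tr_rank G k)%N.
Proof.
by case: k => [|[|k]] //=; rewrite big_const_ord iter_addn_0 ?tt_rank_first
  ?mul1n // mulnC.
Qed.

Lemma rank1_blocks : tr_rank G 1 = (\sum_(j < q) (tr_rank G 1 %/ q))%N.
Proof. by rewrite big_const_ord iter_addn_0 divnK. Qed.

Lemma ei_rank_cyclic : ei_rank d = ei_rank 0.
Proof.
by rewrite !ei_rankE tt_rank_last muln1 (gtn_eqF d_ge2) (gtn_eqF (ltnW d_ge2)).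
Qed.

(* [row_block A j] and [col_block B j] are the j-th blocks in
   A = [A^(1) ... A^(q)] and B = [B^(1); ...; B^(q)]. *)
Definition row_block (m : nat) (A : 'M[R]_(m, tr_rank G 1)) (j : 'I_q) :
    'M[R]_(m, tr_rank G 1 %/ q) :=
  submxrow (castmx (erefl, rank1_blocks) A) j.

Definition col_block (p : nat) (B : 'M[R]_(tr_rank G 1, p)) (j : 'I_q) :
    'M[R]_(tr_rank G 1 %/ q, p) :=
  submxcol (castmx (rank1_blocks, erefl) B) j.

(* \mxdiag only accepts square blocks. *)
Definition blockdiag (m p : nat) (A : 'M[R]_(m, p)) :
    'M[R]_(\sum_(j < q) m, \sum_(l < q) p) :=
  \mxblock_(j < q, l < q) (if j == l then A else 0).

Definition ei_core (k : 'I_d) : 'I_(n k) -> 'M[R]_(ei_rank k, ei_rank k.+1) :=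
  let: Ordinal k' lt_k'd := k in
  match k' return forall lt_k'd : (k' < d)%N,
      'I_(n (Ordinal lt_k'd)) -> 'M[R]_(ei_rank k', ei_rank k'.+1) with
  | 0 => fun lt_0d i => \mxcol_(j < q) row_block (tr_core G i) j
  | 1 => fun lt_1d i => \mxrow_(j < q) col_block (tr_core G i) j
  | _.+2 => fun lt_kd i => blockdiag (tr_core G i)
  end lt_k'd.

Definition edge_insertion : tr_rep R n := TRRep ei_core ei_rank_cyclic.

End EdgeInsertion.

(* Main.v *)
Require Import Defs.
From mathcomp Require Import all_boot all_order all_algebra.
From mathcomp Require Import reals.

(** Edge insertion trades the inner product over the bond between the first two
    cores for a trace.  Cut that bond into [q] pieces, so that [A = G_1(i_1)]
    is a row of blocks [A^(j)] and [B = G_2(i_2)] a column of blocks [B^(l)].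
    Stacking the former vertically and the latter horizontally turns the
    product [A B = \sum_j A^(j) B^(j)] into the block matrix whose [(j, l)]
    block is [A^(j) B^(l)]: the old product is the sum of the diagonal blocks
    of the new one.  Multiplying on the right by a block diagonal matrix with
    equal blocks [C] multiplies every block by [C], so this relation survives
    all the remaining cores ([ei_prod_blocks]).  At the end, the trace of a
    block matrix is the sum of the traces of its diagonal blocks, hence the
    trace of the sum of those blocks, which is the original tensor entry. *)

Set Implicit Arguments.
Unset Strict Implicit.
Unset Printing Implicit Defensive.

Import GRing.Theory.
Local Open Scope ring_scope.

(** Casts along equalities of ranks are unavoidable because the cyclic condition
    [r_d = r_0] is propositional; the point here is that a cast of the whole
    block matrix is a cast of each block. *)
Lemma mxtrace_cast_mxblock (R : realType) (q r s : nat) (e : r = s)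
    (e' : (\sum_(j < q) r = \sum_(j < q) s)%N) (W : 'I_q -> 'I_q -> 'M[R]_(s, r)) :
  \tr (castmx (erefl, e') (\mxblock_(j < q, l < q) W j l)) =
  \tr (castmx (erefl, e) (\sum_(j < q) W j j)).
Proof.
case: s / e e' W => e' W.
by rewrite !castmx_id mxtrace_mxblock raddf_sum.
Qed.

Lemma mul_mxblock_blockdiag (R : realType) (q m p r : nat)
    (W : 'I_q -> 'I_q -> 'M[R]_(m, p)) (A : 'M[R]_(p, r)) :
  (\mxblock_(j < q, l < q) W j l) *m blockdiag q A =
  \mxblock_(j < q, l < q) (W j l *m A).
Proof.
rewrite /blockdiag mul_mxblock; apply: eq_mxblock => j l.
rewrite (bigD1 l) //= eqxx big1 ?addr0 // => k /negPf ->.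
by rewrite mulmx0.
Qed.

Section EdgeInsertionProducts.
Variables (R : realType) (d : nat) (n : 'I_d -> nat).
Variables (G : tt_rep R n) (q : nat).
Hypotheses (d_ge2 : (2 <= d)%N) (q_dvd : (q %| tr_rank G 1)%N).

Lemma sum_row_col_block (m p : nat) (A : 'M[R]_(m, tr_rank G 1))
    (B : 'M[R]_(tr_rank G 1, p)) :
  \sum_(j < q) row_block q_dvd A j *m col_block q_dvd B j = A *m B.
Proof.
rewrite /row_block /col_block -mul_mxrow_mxcol submxrowK submxcolK.
by case: _ / (rank1_blocks q_dvd); rewrite !castmx_id.
Qed.

(** The invariant starts at two factors: with the first core alone the cut bond
    is still open, so that the column dimension is [r_1 %/ q] and there are no
    diagonal blocks to add up. *)
Lemma ei_prod_blocks (i : multi_index n) (k : nat) (le_kd : (k.+2 <= d)%N) :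
  exists2 W : 'I_q -> 'I_q -> 'M[R]_(tr_rank G 0, tr_rank G k.+2),
    tr_prod (edge_insertion d_ge2 q_dvd) i le_kd =
      \mxblock_(j < q, l < q) W j l
    & \sum_(j < q) W j j = tr_prod G i le_kd.
Proof.
elim: k le_kd => [|k IHk] le_kd.
  pose A := tr_core G (i (Ordinal (ltnW le_kd))).
  pose B := tr_core G (i (Ordinal le_kd)).
  exists (fun j l => row_block q_dvd A j *m col_block q_dvd B l).
    by rewrite /= !mul1mx mul_mxcol_mxrow.
  by rewrite sum_row_col_block /= mul1mx.
have [W prodW sumW] := IHk (ltnW le_kd).
pose C := tr_core G (i (Ordinal le_kd)).
exists (fun j l => W j l *m C).
  by rewrite -mul_mxblock_blockdiag -prodW.
by rewrite -mulmx_suml sumW.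
Qed.

End EdgeInsertionProducts.

Theorem theorem4p3 (R : realType) (d : nat) (n : 'I_d -> nat)
    (d_ge2 : (2 <= d)%N) (T : tensor R n) (G : tt_rep R n)
    (GT : represents G T)
    (q : nat) (q_dvd : (q %| tr_rank G 1)%N) (i : multi_index n) :
  tr_tensor (edge_insertion d_ge2 q_dvd) i = T i.
Proof.
rewrite GT {T GT} /tr_tensor.
(* Exposing [d] as a double successor makes the last rank of the output reduce
   to a sum of [q] copies of [r_d], as required by the block matrix form. *)
case: d n d_ge2 G q_dvd i => [|[|d]] // n d_ge2 G q_dvd i.
have [W -> <-] := ei_prod_blocks d_ge2 q_dvd i (leqnn d.+2).
exact: mxtrace_cast_mxblock.
Qed.
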